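(* Let $m\ge1$, let $\Lambda=(\alpha_1,\ldots,\alpha_m;\beta)$ be an integral dominant weight, i.e. $\alpha_1\ge\cdots\ge\alpha_m$ and $\beta$ are integers, and let $\sigma=(1,\ldots,1;-1)$ ($m$ ones). Then there is a unique integer $j$ such that $\Lambda':=\Lambda+j\sigma$ has the form $$\Lambda'=(\lambda_1,\lambda_2,\ldots,\lambda_m;-k)$$ with $0\le k\le m$ and $\lambda_{m-k}\ge0\ge\lambda_{m-k+1}$; that is, $\Lambda'$ is a special weight.
   Context: Addition of weights and integer multiples are component-wise on $(m+1)$-tuples. In the condition $\lambda_{m-k}\ge0\ge\lambda_{m-k+1}$, an inequality involving an index outside $\{1,\ldots,m\}$ is void (for $k=0$ the condition is $\lambda_m\ge0$; for $k=m$ it is $0\ge\lambda_1$). An integral dominant weight of this form is called a special weight. *)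

(* Defs.v *)
From HB Require Import structures.
From mathcomp Require Import all_boot all_order all_algebra.

Set Implicit Arguments.
Unset Strict Implicit.
Unset Printing Implicit Defensive.

Import Order.TTheory GRing.Theory Num.Theory.
Local Open Scope ring_scope.

(* An integral weight (a_1, ..., a_m; b) is the pair of the row of the a_i    *)
(* and the integer b; addition and integer multiples are the library's        *)
(* component-wise operations on pairs and row vectors. The coordinate written *)
(* a_p on paper (1 <= p <= m) is [wt_coord L i] with [i.+1 = p].              *)
Notation weight m := ('rV[int]_m * int)%type.

Definition wt_coord (m : nat) (L : weight m) (i : 'I_m) : int := L.1 0 i.

Definition dominant (m : nat) (L : weight m) : Prop :=
  forall i j : 'I_m, (i <= j)%N -> wt_coord L j <= wt_coord L i.

Definition sigma (m : nat) : weight m := (const_mx 1, -1).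

(* The two inequalities are quantified over the indices i with i.+1 equal to  *)
(* the required 1-based position, so they are void when it is not in 1..m.    *)
Definition special_form (m : nat) (L : weight m) (k : nat) : Prop :=
  [/\ (k <= m)%N,
      L.2 = - k%:Z,
      forall i : 'I_m, i.+1 = (m - k)%N -> 0 <= wt_coord L i
    & forall i : 'I_m, i.+1 = (m - k + 1)%N -> wt_coord L i <= 0].

Definition special_weight (m : nat) (L : weight m) : Prop :=
  dominant L /\ exists k : nat, special_form L k.

(* Main.v *)
Require Import Defs.
From mathcomp Require Import all_boot all_order all_algebra.
From mathcomp Require Import zify.

Set Implicit Arguments.
Unset Strict Implicit.
Unset Printing Implicit Defensive.

Import Order.TTheory GRing.Theory Num.Theory.
Local Open Scope ring_scope.

(* The last entry of L + j sigma forces j = b + k, where b is the last entry  *)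
(* of L, so everything reduces to k. Put c_p = a_p + b. For existence, take   *)
(* the least k >= 0 such that k = m or c_(m-k) + k >= 0: if k > 0, then       *)
(* k - 1 fails, so c_(m-k+1) + k - 1 < 0, that is c_(m-k+1) + k <= 0. For     *)
(* uniqueness, k < k' gives m-k >= m-k'+1, hence by dominance                 *)
(* -k <= c_(m-k) <= c_(m-k'+1) <= -k', a contradiction.                       *)

Lemma wt_coord_shift (m : nat) (L : weight m) (j : int) (i : 'I_m) :
  wt_coord (L + sigma m *~ j) i = wt_coord L i + j.
Proof.
rewrite /wt_coord /= raddfMz mxE -scaler_int !mxE mulr1.
by rewrite intz.
Qed.

Lemma last_shift (m : nat) (L : weight m) (j : int) :
  (L + sigma m *~ j).2 = L.2 - j.
Proof. by rewrite /= raddfMz /= mulNrz intz. Qed.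

Lemma dominant_shift (m : nat) (L : weight m) (j : int) :
  dominant L -> dominant (L + sigma m *~ j).
Proof. by move=> hL p q le_pq; rewrite !wt_coord_shift lerD2r hL. Qed.

Lemma special_shift_exists (m : nat) (L : weight m) :
  exists k : nat, special_form (L + sigma m *~ (L.2 + k%:Z)) k.
Proof.
pose P k := [forall i : 'I_m, (i.+1 == m - k)%N ==>
  (0 <= wt_coord L i + (L.2 + k%:Z))].
(* Vacuous: position m - m = 0 is not an index, so the search for the least k ends by m. *)
have Pm : P m by apply/forallP => i; rewrite subnn.
have [k Pk k_min] := ex_minnP (ex_intro P m Pm).
have le_km := k_min m Pm.
exists k; split=> //.
- by rewrite last_shift; lia.
- move=> i /eqP i_eq; rewrite wt_coord_shift.
  exact: (implyP (forallP Pk i)).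
move=> i i_eq; rewrite wt_coord_shift leNgt; apply/negP => lt0.
have k_gt0 : (0 < k)%N by have := ltn_ord i; lia.
(* By integrality, a positive entry at position m-k+1 = m-(k-1) stays nonnegative when the shift
   drops by 1, against the minimality of k. *)
suff /k_min : P k.-1 by lia.
apply/forallP => p; apply/implyP => /eqP p_eq.
have -> : p = i by apply: val_inj => /=; lia.
by lia.
Qed.

(** One-sided, so that exchanging the two forms yields k = k'; the last entries then give j = j'. *)
Lemma special_shift_le (m : nat) (L : weight m) (j j' : int) (k k' : nat) :
    dominant L -> special_form (L + sigma m *~ j) k ->
  special_form (L + sigma m *~ j') k' -> (k' <= k)%N.
Proof.
move=> hL [_ hk ge0 _] [le_k'm hk' _ le0]; rewrite leqNgt; apply/negP => lt_kk'.
(* Zero-based indices of the positions m-k and m-k'+1, which exist because k < k' <= m. *)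
have lt_p : (m - k.+1 < m)%N by lia.
have lt_q : (m - k' < m)%N by lia.
have /ge0 : (Ordinal lt_p).+1 = (m - k)%N by rewrite /=; lia.
have /le0 : (Ordinal lt_q).+1 = (m - k' + 1)%N by rewrite /=; lia.
have /hL : (Ordinal lt_q <= Ordinal lt_p)%N by rewrite /=; lia.
move: hk hk'; rewrite !last_shift !wt_coord_shift.
by lia.
Qed.

Theorem proposition4p2 (m : nat) (hm : (1 <= m)%N) (L : weight m)
    (hL : dominant L) :
  exists! j : int, special_weight (L + sigma m *~ j).
Proof.
have [k hk] := special_shift_exists L.
exists (L.2 + k%:Z); split.
  by split; [exact: dominant_shift | exists k].
move=> j [_ [k' hk']].
have le_k'k := special_shift_le hL hk hk'.
have le_kk' := special_shift_le hL hk' hk.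
by case: hk' => _ + _ _; rewrite last_shift; lia.
Qed.
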